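(* Let $A_5$ be the alternating group of degree 5. The following d-identities form a basis of d-identities of $A_5$; that is, each of them holds in $A_5$, and every group in which all of them hold is isomorphic to a section (a quotient of a subgroup) of $A_5$: (1) $\omega_{60}=\bigvee_{0\le i<j\le 60}(x_i=x_j)$; (2) $(x^2=1)\vee(x^3=1)\vee(x^5=1)$; (3) in variables $x_1,x_2,x_3$: $\Big[\bigvee_{i=1}^{3} x_i^{15}=1\Big]\vee\Big[\bigvee_{1\le i<j\le 3}(x_ix_j)^{15}=1\Big]\vee\Big[\bigvee_{(i,j,k)} x_1^{i}x_2^{j}x_3^{k}=1\Big]$, where the last disjunction runs over all nonzero vectors $(i,j,k)\in\{0,1\}^3$; (4) $(x_1^{10}=1)\vee(x_2^{10}=1)\vee(x_1=x_2)\vee((x_1x_2)^{10}=1)\vee((x_1^2x_2)^2=1)$; (5) $(x_1^6=1)\vee(x_2^6=1)\vee\bigvee_{d=1}^{4}\big((x_1x_2^d)^6=1\big)$.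
   Context: A d-identity (disjunctive identity) is a universally quantified formula $\forall x_1\dots x_k\,[(f_1=1)\vee\dots\vee(f_n=1)]$, where the $f_i$ are words in the free group on $x_1,\dots,x_k$; an equation $u=v$ abbreviates $uv^{-1}=1$. A group satisfies a d-identity if the formula is true for every assignment of group elements to the variables. For a group $G$, $\mathrm{dvar}(G)$ is the class of all groups satisfying every d-identity satisfied by $G$; for finite $G$ this is exactly the class of groups isomorphic to sections (quotients of subgroups) of $G$. A set $\Sigma$ of d-identities is a basis of d-identities of $G$ if every member of $\Sigma$ holds in $G$ and every group satisfying all members of $\Sigma$ lies in $\mathrm{dvar}(G)$. *)

(* Defs.v *)
From HB Require Import structures.
From mathcomp Require Import all_boot all_order all_fingroup all_solvable.
From mathcomp Require Import alt.
From Stdlib Require List.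
Set Implicit Arguments. Unset Strict Implicit. Unset Printing Implicit Defensive.

Record Grp := MkGrp {
  gcar :> Type;
  gmul : gcar -> gcar -> gcar;
  gone : gcar;
  ginv : gcar -> gcar;
  gmulA : forall x y z, gmul x (gmul y z) = gmul (gmul x y) z;
  gmul1 : forall x, gmul gone x = x;
  gmulV : forall x, gmul (ginv x) x = gone
}.

Definition Grp_of_fin (gT : finGroupType) : Grp :=
  @MkGrp gT mulg 1%g invg (@mulgA gT) (@mul1g gT) (@mulVg gT).

Definition A5 : Grp := Grp_of_fin [subg (Alt_group 'I_5)].

Inductive word (k : nat) : Type :=
| WVar of 'I_k
| WOne
| WMul of word k & word k
| WInv of word k.

Fixpoint weval (G : Grp) k (x : 'I_k -> G) (w : word k) : G :=
  match w with
  | WVar i => x i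
  | WOne => gone G
  | WMul u v => gmul (weval x u) (weval x v)
  | WInv u => ginv (weval x u)
  end.

Fixpoint wpow k (w : word k) (n : nat) : word k :=
  if n is n'.+1 then WMul (wpow w n') w else WOne k.

(* u = v abbreviates u v^{-1} = 1 *)
Definition weq k (u v : word k) : word k := WMul u (WInv v).

Definition dsat (G : Grp) k (fs : seq (word k)) : Prop :=
  forall x : 'I_k -> G, exists2 f, List.In f fs & weval x f = gone G.


Definition did1 : seq (word 61) :=
  map (fun ij : 'I_61 * 'I_61 => weq (WVar ij.1) (WVar ij.2))
    (filter (fun ij : 'I_61 * 'I_61 => (ij.1 < ij.2)%N)
       (allpairs pair (enum 'I_61) (enum 'I_61))).

Definition did2 : seq (word 1) :=
  let x := @WVar 1 ord0 in [:: wpow x 2; wpow x 3; wpow x 5].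

Definition did3 : seq (word 3) :=
  let x1 := @WVar 3 (@Ordinal 3 0 isT) in
  let x2 := @WVar 3 (@Ordinal 3 1 isT) in
  let x3 := @WVar 3 (@Ordinal 3 2 isT) in
  [:: wpow x1 15; wpow x2 15; wpow x3 15;
      wpow (WMul x1 x2) 15; wpow (WMul x1 x3) 15; wpow (WMul x2 x3) 15] ++
  map (fun ijk : nat * nat * nat =>
         WMul (WMul (wpow x1 ijk.1.1) (wpow x2 ijk.1.2)) (wpow x3 ijk.2))
    (filter (fun ijk : nat * nat * nat => (ijk.1.1 + ijk.1.2 + ijk.2 != 0)%N)
       (allpairs pair (allpairs pair [:: 0; 1] [:: 0; 1]) [:: 0; 1])).

Definition did4 : seq (word 2) :=
  let x1 := @WVar 2 (@Ordinal 2 0 isT) in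
  let x2 := @WVar 2 (@Ordinal 2 1 isT) in
  [:: wpow x1 10; wpow x2 10; weq x1 x2; wpow (WMul x1 x2) 10;
      wpow (WMul (wpow x1 2) x2) 2].

Definition did5 : seq (word 2) :=
  let x1 := @WVar 2 (@Ordinal 2 0 isT) in
  let x2 := @WVar 2 (@Ordinal 2 1 isT) in
  [:: wpow x1 6; wpow x2 6] ++
  [seq wpow (WMul x1 (wpow x2 d)) 6 | d <- [:: 1; 2; 3; 4]].

Definition satisfies_all (G : Grp) : Prop :=
  [/\ dsat G did1, dsat G did2, dsat G did3, dsat G did4 & dsat G did5].

Definition section_of_A5 (G : Grp) : Prop :=
  exists (H N : {group {perm 'I_5}}),
    [/\ (H \subset Alt 'I_5)%g, (N <| H)%g &
      exists f : coset_of N -> G,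
        [/\ {in (H / N)%g &, forall a b, f (a * b)%g = gmul (f a) (f b)},
            {in (H / N)%g &, injective f} &
            forall g : G, exists2 c, c \in (H / N)%g & f c = g]].

(* Main.v *)
Require Import Defs.
From HB Require Import structures.
From mathcomp Require Import all_boot all_order all_fingroup all_solvable.
From mathcomp Require Import alt.
From Stdlib Require Import Classical ClassicalEpsilon.
Set Implicit Arguments. Unset Strict Implicit. Unset Printing Implicit Defensive.
Local Open Scope group_scope.

(** That A_5 satisfies the identities is a finite computation. Conversely, (1)
makes G finite and (2) says that all element orders lie in {1, 2, 3, 5}.
Identities (3), (4) and (5) forbid subgroups of order 8, 9 and 25, so |G|
divides 60. Centralizers of nontrivial elements are p-groups, hence abelian
Sylow subgroups meet trivially, and |N_G(P)| divides 2p if |P| = p is 3 or 5.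
Sylow counting leaves the orders 1, 2, 3, 4, 5, 6, 10, 12 and 60, and in each
case the group is determined up to isomorphism: elementary abelian, dihedral
(generated by two involutions), A_4 (acting on 4 Sylow 3-subgroups) or A_5
(acting on 5 Sylow 2-subgroups). The same counts, applied to A_5 itself, show
that the normalizers of its Sylow subgroups have orders 6, 10 and 12, so that
all these groups embed into A_5. *)

(** * Groups with element orders 1, 2, 3 and 5 *)

Definition orders1235 (gT : finGroupType) (G : {set gT}) :=
  {in G, forall x, #[x] \in [:: 1; 2; 3; 5]%N}.

Definition order_class (gT : finGroupType) (G : {set gT}) p : {set gT} :=
  [set x in G | #[x] == p].

Section Orders1235.
Variable gT : finGroupType.
Implicit Types (G H K P Q S : {group gT}) (p : nat).

Lemma orders1235S (H G : {set gT}) :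
  H \subset G -> orders1235 G -> orders1235 H.
Proof. by move=> /subsetP sHG oG x /sHG/oG. Qed.

(** If neither were 1, [x * y] would have order [#[x] * #[y]], a composite number, and no composite
    order is allowed. *)
Lemma commute_coprime_orders1235 G x y :
    orders1235 G -> x \in G -> y \in G -> commute x y ->
  coprime #[x] #[y] -> (x == 1) || (y == 1).
Proof.
move=> oG Gx Gy cxy co_xy; rewrite -!order_eq1.
move: (oG _ (groupM Gx Gy)); rewrite orderM //.
move: co_xy (oG _ Gx) (oG _ Gy); rewrite !inE.
by move=> + /or4P[] /eqP-> /or4P[] /eqP->.
Qed.

(** By Cauchy, a second prime divisor would give an element of coprime order commuting with [x]. *)
Lemma pgroup_cent1 G p x :
  orders1235 G -> x \in G -> prime p -> #[x] = p -> p.-group 'C_G[x].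
Proof.
move=> oG Gx p_pr ox; apply/pgroupP=> q q_pr /(Cauchy q_pr)[y].
rewrite inE => /andP[Gy /cent1P cxy] oy; rewrite inE /=.
apply: contraT => neq_qp.
have: coprime #[x] #[y].
  by rewrite ox oy prime_coprime // dvdn_prime2 // eq_sym.
case/(commute_coprime_orders1235 oG Gx Gy (commute_sym cxy))/orP=> /eqP e.
  by move: p_pr; rewrite -ox e order1.
by move: q_pr; rewrite -oy e order1.
Qed.

Lemma order_pelt G p x :
  orders1235 G -> prime p -> x \in G -> p.-elt x -> x != 1 -> #[x] = p.
Proof.
move=> oG p_pr Gx px ntx; have := oG x Gx.
have p1 := prime_gt1 p_pr.
rewrite !inE order_eq1 (negPf ntx) /=; move: px; rewrite /p_elt.
by move=> /[swap] /or3P[] /eqP->; rewrite pnatE // inE /= => /eqP.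
Qed.

Lemma cent1_abelian_Sylow G P p x :
    orders1235 G -> prime p -> p.-Sylow(G) P -> abelian P -> x \in P^# ->
  'C_G[x] = P.
Proof.
move=> oG p_pr sylP abP /setD1P[ntx Px].
have [sPG pP _] := and3P sylP; have Gx := subsetP sPG x Px.
have ox : #[x] = p by apply: (order_pelt oG p_pr Gx _ ntx); apply: mem_p_elt Px.
apply: (sub_pHall sylP); rewrite ?subsetIl ?(pgroup_cent1 oG) //.
by rewrite subsetI sPG sub_cent1 (subsetP abP).
Qed.

(** Each nontrivial element of [P] determines [P] as its centralizer, so distinct conjugates of [P]
    meet trivially. *)
Lemma card_class_support_Sylow G P p :
    orders1235 G -> prime p -> p.-Sylow(G) P -> abelian P -> P :!=: 1 ->
  #|class_support P^# G| = (#|P|.-1 * #|G : 'N_G(P)|)%N.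
Proof.
move=> oG p_pr sylP abP ntP; rewrite (@card_support_normedTI _ _ _ 'N_G(P)).
  by rewrite [in RHS](cardsD1 1 P) group1.
apply/normedTI_P; split.
- by apply: contra ntP; rewrite setD_eq0 subG1.
- by rewrite normD1 setIS // subsetI subxx subsetIl.
move=> g Gg /pred0Pn[x /= /andP[Px]]; rewrite conjD1g => Pgx.
rewrite inE Gg; apply/normP.
have sylPg : p.-Sylow(G) (P :^ g) by rewrite pHallJ.
have abPg : abelian (P :^ g) by rewrite abelianJ.
have <- := cent1_abelian_Sylow oG p_pr sylPg abPg Pgx.
exact: cent1_abelian_Sylow oG p_pr sylP abP Px.
Qed.

Lemma leq_order_class G P p :
    orders1235 G -> prime p -> p.-Sylow(G) P -> abelian P ->
  (#|P|.-1 * #|'Syl_p(G)| <= #|order_class G p|)%N.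
Proof.
move=> oG p_pr sylP abP; rewrite (card_Syl sylP).
have [-> | ntP] := eqVneq (P : {set gT}) 1; first by rewrite cards1.
rewrite -(card_class_support_Sylow oG p_pr sylP abP ntP) subset_leq_card //.
apply/subsetP=> _ /imset2P[x g /setD1P[ntx Px] Gg ->].
have [sPG pP _] := and3P sylP; have Gx := subsetP sPG x Px.
rewrite inE groupJ //= orderJ (order_pelt oG p_pr) //.
exact: mem_p_elt Px.
Qed.

Lemma disjoint_order_class (G : {set gT}) p q :
  p != q -> [disjoint order_class G p & order_class G q].
Proof.
move=> neq_pq; apply/pred0P=> x /=; rewrite !inE; case: (x \in G) => //=.
by case: eqP => // ->; apply: negPf.
Qed.

Lemma card_order_classes G :
    #|order_class G 2| + #|order_class G 3| + #|order_class G 5| < #|G|.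
Proof.
rewrite (cardsD1 1 G) group1 add1n ltnS.
have d23: [disjoint order_class G 2 & order_class G 3].
  exact: disjoint_order_class.
have d5: [disjoint order_class G 2 :|: order_class G 3 & order_class G 5].
  apply/pred0P=> x /=; rewrite !inE; case: (x \in G) => //=.
  by rewrite andbC; case: eqP => // ->.
have cU (A B : {set gT}) : [disjoint A & B] -> #|A :|: B| = (#|A| + #|B|)%N.
  by move=> dAB; apply/eqP; rewrite (leq_card_setU A B).
rewrite -cU // -cU //; apply/subset_leq_card/subsetP=> x.
rewrite !inE -!andb_orr andbC => /andP[o ->]; rewrite andbT -order_eq1.
by apply: contraTneq o => ->.
Qed.

(* H acts faithfully on P and Aut P is cyclic of order p - 1. *)
Lemma card_norm_prime G P H p :
    orders1235 G -> prime p -> #|P| = p -> P \subset G ->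
    H \subset 'N_G(P) -> coprime p #|H| ->
  cyclic H /\ #|H| %| p.-1.
Proof.
move=> oG p_pr oP sPG; rewrite subsetI => /andP[sHG nPH] coH.
have cH1 : 'C_H(P) = 1.
  apply/trivgP/subsetP=> y /setIP[Hy cPy].
  have [x Px ox] : {x | x \in P & #[x] = p} by apply: Cauchy; rewrite ?oP.
  have := commute_coprime_orders1235 oG (subsetP sPG x Px) (subsetP sHG y Hy).
  case/(_ _ _)/orP=> [||/eqP x1|]; last by rewrite inE.
  - exact/commute_sym/(centP cPy).
  - by rewrite ox (coprime_dvdr (order_dvdG Hy)).
  by move: p_pr; rewrite -ox x1 order1.
have injH: 'injm (restrm nPH (conj_aut P)).
  by rewrite ker_restrm ker_conj_aut cH1.
have sA: restrm nPH (conj_aut P) @* H \subset Aut P.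
  by rewrite morphim_restrm setIid Aut_conj_aut.
split.
  by rewrite -(injm_cyclic injH) // (cyclicS sA) // Aut_prime_cyclic ?oP.
rewrite -(card_injm injH) // (dvdn_trans (cardSg sA)) //.
by rewrite card_Aut_cyclic ?oP ?totient_prime ?prime_cyclic ?oP.
Qed.

(** * Sylow counting in groups of order dividing 60 *)

Lemma abelian_Sylow60 G P p :
  #|G| %| 60 -> p \in primes 60 -> p.-Sylow(G) P -> abelian P.
Proof.
move=> G60 p60 sylP; apply: p2group_abelian (pHall_pgroup sylP) _.
have: logn p #|P| <= logn p 60.
  by apply: dvdn_leq_log => //; apply: dvdn_trans (cardSg (pHall_sub sylP)) G60.
move/leq_trans; apply; move: p60; rewrite (_ : primes 60 = [:: 2; 3; 5]%N) //.
by rewrite !inE => /or3P[] /eqP->.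
Qed.

Lemma card_cent1_60 G x :
  orders1235 G -> #|G| %| 60 -> x \in G -> x != 1 -> #|'C_G[x]| <= 5.
Proof.
move=> oG G60 Gx; rewrite -order_eq1 => ntx.
have pC p : prime p -> #[x] = p -> #|'C_G[x]| <= p ^ logn p 60.
  move=> p_pr ox; have pC := pgroup_cent1 oG Gx p_pr ox.
  rewrite -p_part -(part_pnat_id pC) dvdn_leq ?part_gt0 // partn_dvd //.
  exact: dvdn_trans (cardSg (subsetIl _ _)) G60.
move: ntx (pC #[x]) (oG x Gx); rewrite !inE => /negPf->.
by move=> /= h /or3P[] /eqP e; rewrite e in h; apply: leq_trans (h _ _) _.
Qed.

(* Nontrivial conjugacy classes have at least |G| / 5 elements. *)
Lemma small_normal_trivial G K :
    orders1235 G -> #|G| %| 60 -> K <| G -> 5 * #|K|.-1 < #|G| ->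
  K :=: 1.
Proof.
move=> oG G60 /andP[sKG nKG] ltKG; apply/trivgP/subsetP=> x Kx; rewrite inE.
apply: contraLR ltKG => ntx; have Gx := subsetP sKG x Kx.
rewrite -leqNgt -(Lagrange (subsetIl G 'C[x])) leq_mul ?card_cent1_60 //.
rewrite index_cent1 (cardsD1 1 K) group1 subset_leq_card //.
by rewrite class_sub_norm ?normD1 // !inE ntx.
Qed.

(** For a prime q other than p, a Sylow q-subgroup of the normalizer is cyclic and its order divides
    p - 1, which is 2 or 4; as no element has order 4, the order divides 2. The prime p itself
    divides 60 only once. *)
Lemma card_norm_Sylow35 G P p :
    orders1235 G -> #|G| %| 60 -> p \in [:: 3; 5]%N -> P \subset G ->
    #|P| = p ->
  #|'N_G(P)| %| p.*2.
Proof.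
move=> oG G60 p35 sPG oP.
have p_pr : prime p by move: p35; rewrite !inE => /orP[]/eqP->.
have N60 : #|'N_G(P)| \in divisors 60.
  by rewrite -dvdn_divisors // (dvdn_trans (cardSg (subsetIl _ _))).
have qN q : prime q -> q != p -> (q ^ logn q #|'N_G(P)| %| 2)%N.
  move=> q_pr neq_qp; have [H sylH] := Sylow_exists q 'N_G(P).
  rewrite -p_part -(card_Hall sylH); have sHN := pHall_sub sylH.
  have coH : coprime p #|H|.
    rewrite coprime_sym (pnat_coprime (pHall_pgroup sylH)) // pnatE //.
    by rewrite !inE eq_sym.
  have [/cyclicP[x defH] ] := card_norm_prime oG p_pr oP sPG sHN coH.
  have Gx : x \in G.
    by rewrite -cycle_subG -defH (subset_trans sHN) ?subsetIl.
  have := oG x Gx; rewrite defH -orderE.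
  by move: p35; rewrite !inE => /orP[]/eqP-> /or4P[]/eqP->.
have : all (fun n => all (fun p => all (fun q =>
    (q != p) ==> (q ^ logn q n %| 2)) [:: 2; 3; 5] ==> (n %| p.*2))
  [:: 3; 5]) (divisors 60) by vm_compute.
move/allP/(_ _ N60)/allP/(_ _ p35)/implyP; apply; apply/allP=> q q235.
by apply/implyP/qN; move: q235; rewrite !inE => /or3P[] /eqP->.
Qed.

Lemma card_Sylow35 G P p :
    #|G| %| 60 -> p \in [:: 3; 5]%N -> p %| #|G| -> p.-Sylow(G) P -> #|P| = p.
Proof.
move=> G60 p35 pG sylP; rewrite (card_Hall sylP) p_part.
have : all (fun n => all (fun p => (p %| n) ==> (p ^ logn p n == p)%N)
  [:: 3; 5]) (divisors 60) by vm_compute.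
rewrite dvdn_divisors // in G60.
by move/allP/(_ _ G60)/allP/(_ _ p35)/implyP/(_ pG)/eqP.
Qed.

(** The Sylow number is the index of a normalizer whose order divides 2p. As membership in a
    filtered list, this can be evaluated once [#|G|] is known. *)
Lemma card_Syl35 G p :
    orders1235 G -> #|G| %| 60 -> p \in [:: 3; 5]%N -> p %| #|G| ->
  #|'Syl_p(G)| \in
    [seq s <- [seq #|G| %/ n | n <- divisors p.*2 & n %| #|G|] | s %% p == 1]%N.
Proof.
move=> oG G60 p35 pG; have [P sylP] := Sylow_exists p G.
rewrite mem_filter card_Syl_mod ?eqxx /=; last first.
  by move: p35; rewrite !inE => /orP[]/eqP->.
apply/mapP; exists #|'N_G(P)|; last by rewrite (card_Syl sylP) divgS ?subsetIl.
rewrite mem_filter cardSg ?subsetIl // -dvdn_divisors; last by case: (p) p35.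
exact: card_norm_Sylow35 (pHall_sub sylP) (card_Sylow35 _ _ _ sylP).
Qed.

Lemma leq_order_class35 G p :
    orders1235 G -> #|G| %| 60 -> p \in [:: 3; 5]%N -> p %| #|G| ->
  p.-1 * #|'Syl_p(G)| <= #|order_class G p|.
Proof.
move=> oG G60 p35 pG; have [P sylP] := Sylow_exists p G.
have p_pr : prime p by move: p35; rewrite !inE => /orP[]/eqP->.
have abP : abelian P.
  apply: abelian_Sylow60 G60 _ sylP.
  by move: p35; rewrite !inE => /orP[]/eqP->.
rewrite -{1}(card_Sylow35 G60 p35 pG sylP).
exact: (leq_order_class oG p_pr sylP abP).
Qed.

(** Orders 15 and 20 admit no number of Sylow 5-subgroups. Order 30 would force 6 Sylow 5-subgroups
    and 10 Sylow 3-subgroups, hence 24 + 20 elements. *)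
Lemma card_order60 G :
    orders1235 G -> #|G| %| 60 ->
  #|G| \in [:: 1; 2; 3; 4; 5; 6; 10; 12; 60]%N.
Proof.
move=> oG G60; have := card_order_classes G.
have := leq_order_class35 oG G60 (isT : 3 \in [:: 3; 5]%N).
have := leq_order_class35 oG G60 (isT : 5 \in [:: 3; 5]%N).
have := card_Syl35 oG G60 (isT : 5 \in [:: 3; 5]%N).
have := card_Syl35 oG G60 (isT : 3 \in [:: 3; 5]%N).
move: G60; rewrite dvdn_divisors // => G60.
have : all (fun n => (n \in [:: 1; 2; 3; 4; 5; 6; 10; 12; 60]%N)
    || (n \in [:: 15; 20; 30]%N)) (divisors 60) by vm_compute.
move/allP/(_ _ G60)/orP; case=> //.
rewrite 3!inE => /or3P[] /eqP-> s3 s5 e5 e3 lt_e.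
- by move: (s5 isT); rewrite (_ : filter _ _ = [::]) ?in_nil.
- by move: (s5 isT); rewrite (_ : filter _ _ = [::]) ?in_nil.
move: (s5 isT) (e5 isT); rewrite (_ : filter _ _ = [:: 6]%N) // inE.
move=> /eqP-> {}e5.
move: (s3 isT) (e3 isT); rewrite (_ : filter _ _ = [:: 10]%N) // inE.
move=> /eqP-> {}e3.
have := leq_trans (leq_add e3 e5) (leq_trans _ (ltnW lt_e)).
by rewrite leq_add2r leq_addl => /(_ isT).
Qed.

Lemma card_order12 G :
    orders1235 G -> #|G| = 12 ->
  #|'Syl_3(G)| = 4 /\ 8 <= #|order_class G 3|.
Proof.
move=> oG G12; have G60 : #|G| %| 60 by rewrite G12.
have := leq_order_class35 oG G60 (isT : 3 \in [:: 3; 5]%N).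
have := card_Syl35 oG G60 (isT : 3 \in [:: 3; 5]%N); rewrite G12 => /(_ isT).
by rewrite (_ : filter _ _ = [:: 4]%N) // inE => /eqP-> /(_ isT).
Qed.

Lemma card_order60_35 G :
    orders1235 G -> #|G| = 60 ->
  [/\ #|'Syl_3(G)| = 10, #|'Syl_5(G)| = 6, 20 <= #|order_class G 3|
    & 24 <= #|order_class G 5|].
Proof.
move=> oG Ge; have G60 : #|G| %| 60 by rewrite Ge.
have := leq_order_class35 oG G60 (isT : 3 \in [:: 3; 5]%N).
have := leq_order_class35 oG G60 (isT : 5 \in [:: 3; 5]%N).
have := card_Syl35 oG G60 (isT : 3 \in [:: 3; 5]%N); rewrite Ge => /(_ isT).
have := card_Syl35 oG G60 (isT : 5 \in [:: 3; 5]%N); rewrite Ge => /(_ isT).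
rewrite (_ : filter _ _ = [:: 6]%N) // inE => /eqP->.
rewrite (_ : filter _ _ = [:: 10]%N) // inE => /eqP->.
by move=> /(_ isT) + /(_ isT).
Qed.

Lemma card_order60_2 G :
  orders1235 G -> #|G| = 60 -> #|'Syl_2(G)| = 5.
Proof.
move=> oG Ge; have G60 : #|G| %| 60 by rewrite Ge.
have [S sylS] := Sylow_exists 2 G; have [sSG pS _] := and3P sylS.
have oS : #|S| = 4 by rewrite (card_Hall sylS) p_part Ge.
have [_ _ e3 e5] := card_order60_35 oG Ge.
have abS : abelian S := abelian_Sylow60 G60 (isT : 2 \in primes 60) sylS.
have e2 := leq_order_class oG (isT : prime 2) sylS abS.
(* At least 44 elements have order 3 or 5, which leaves at most 15 involutions, and each Sylow
   2-subgroup has 3 of its own. *)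
have le5 : #|'Syl_2(G)| <= 5.
  rewrite -(leq_pmul2l (isT : 0 < 3)) -(leq_add2r (20 + 24)).
  rewrite oS in e2; apply: leq_trans (leq_add e2 (leq_add e3 e5)) _.
  by rewrite addnA -ltnS -Ge card_order_classes.
(* An element of order 5 normalizing [S] would give a subgroup of order 20, an excluded order. *)
have not5N : ~~ (5 %| #|'N_G(S)|).
  apply/negP=> /(Cauchy (isT : prime 5))[x /setIP[Gx nSx] ox].
  have nSX : <[x]> \subset 'N(S) by rewrite cycle_subG.
  have oSX : #|S <*> <[x]>| = 20.
    by rewrite norm_joinEr // TI_cardMg ?coprime_TIg -?orderE ?oS ?ox.
  have sSXG : S <*> <[x]> \subset G by rewrite join_subG sSG cycle_subG.
  have := card_order60 (orders1235S sSXG oG).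
  by rewrite oSX => /(_ isT).
have dvd4N : 4 %| #|'N_G(S)|.
  by rewrite -oS cardSg // subsetI sSG normG.
have := Lagrange (subsetIl G 'N(S)); rewrite -(card_Syl sylS) Ge.
have N60 : #|'N_G(S)| \in divisors 60.
  by rewrite -dvdn_divisors // -Ge cardSg ?subsetIl.
have : all (fun m => [|| 5 %| m, ~~ (4 %| m), m == 4 | m == 12]%N)
  (divisors 60) by vm_compute.
(* A normalizer of order 4 would give 15 Sylow 2-subgroups, so the order is 12. *)
move/allP/(_ _ N60); rewrite (negPf not5N) dvd4N /= => /orP[] /eqP->.
  move=> e; rewrite -(leq_pmul2l (isT : 0 < 4)) e in le5.
  by [].
by move=> e; apply/eqP; rewrite -(eqn_pmul2l (isT : 0 < 12)) e.
Qed.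

(** * Isomorphism types and embeddings into A_5 *)

Lemma isog_dihedral_2p G p :
  orders1235 G -> prime p -> odd p -> #|G| = p.*2 -> G \isog [set: 'D_(p.*2)].
Proof.
move=> oG p_pr odd_p Ge.
have [y Gy oy] : {y | y \in G & #[y] = 2}.
  by apply: Cauchy => //; rewrite Ge -muln2 dvdn_mull.
have [z Gz oz] : {z | z \in G & #[z] = p}.
  by apply: Cauchy => //; rewrite Ge -muln2 dvdn_mulr.
(* An involution does not commute with an element of order p, so [y] and [y ^ z] are distinct
   involutions and generate a dihedral group. *)
have neq : y != y ^ z.
  apply/eqP=> e; have cyz : commute y z by apply/commgP/conjg_fixP.
  have := commute_coprime_orders1235 oG Gy Gz cyz.
  rewrite oy oz coprime2n odd_p => /(_ isT)/orP[] /eqP e1.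
    by move: oy; rewrite e1 order1.
  by move: p_pr; rewrite -oz e1 order1.
have := involutions_gen_dihedral oy (_ : #[y ^ z] = 2) neq.
have -> : <<[set y; y ^ z]>> = G; last by rewrite Ge orderJ => /(_ oy).
apply/eqP; rewrite eqEcard gen_subG subUset !sub1set Gy groupJ //=.
set H := <<_>>.
have Hy : y \in H by rewrite mem_gen // !inE eqxx.
have Hyz : y ^ z \in H by rewrite mem_gen // !inE eqxx orbT.
have /dvdnP[k oH] : 2 %| #|H| by rewrite -oy order_dvdG.
have : #|H| %| #|G| by rewrite cardSg // gen_subG subUset !sub1set Gy groupJ.
(* The order of [H] is 2k with k dividing p, and k = 1 would put [y ^ z] into [<[y]>]. *)
rewrite Ge oH -muln2 dvdn_pmul2r // => /(primeP p_pr).2/orP[]/eqP k1;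
  last by rewrite k1.
have defH : H = <[y]>.
  by apply/esym/eqP; rewrite eqEcard cycle_subG Hy oH k1 -orderE oy.
have := Hyz; rewrite defH cycle2g // !inE [_ == y]eq_sym (negPf neq) orbF.
rewrite conjg_eq1 => /eqP y1; by move: oy; rewrite y1 order1.
Qed.

End Orders1235.

Lemma acts_isog_Sym (aT : finGroupType) (rT : finType)
    (to : {action aT &-> rT}) (G : {group aT}) (S : {set rT}) n :
    #|S| = n -> [acts G, on S | to] -> 'C_G(S | to) = 1 ->
  exists K : {group 'S_n}, G \isog K.
Proof.
move=> Sn actGS trivC.
pose ev i := enum_val (cast_ord (esym Sn) i) : rT.
have Sev i : ev i \in S by apply: enum_valP.
have ev_inj : injective ev by move=> i j /enum_val_inj/cast_ord_inj.
have ev_onto x : x \in S -> exists i, ev i = x.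
  move=> Sx; exists (cast_ord Sn (enum_rank_in Sx x)).
  by rewrite /ev cast_ordK enum_rankK_in.
pose fg g : {ffun 'I_n -> 'I_n} :=
  [ffun i => cast_ord Sn (enum_rank_in (Sev i) (to (ev i) g))].
(* The default value 1 is never taken for [g] in [G], where [fg g] is injective. *)
pose f g : 'S_n := insubd (1 : 'S_n) (fg g).
have evf g i : g \in G -> ev (f g i) = to (ev i) g.
  move=> Gg; have ev_fg j : ev (fg g j) = to (ev j) g.
    rewrite ffunE /ev cast_ordK enum_rankK_in //.
    by rewrite (actsP actGS) ?(Sev j).
  rewrite -ev_fg; congr ev; rewrite -pvalE.
  rewrite /f [pval _](insubdK (1 : 'S_n)) //.
  apply/injectiveP=> j k /(congr1 ev).
  by rewrite !ev_fg => /act_inj/ev_inj.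
have fM : {in G &, {morph f : g h / g * h}}.
  move=> g h Gg Gh; apply/permP=> i; apply: ev_inj.
  by rewrite permM !evf ?groupM // actM.
exists (Morphism fM @* G)%G; apply: sub_isog => //.
apply/subsetP=> g /morphpreP[Gg /set1P/= fg1].
rewrite -trivC inE Gg; apply/astabP=> x /ev_onto[i <-].
by rewrite -evf // fg1 perm1.
Qed.

Lemma odd_permX (T : finType) (s : {perm T}) n :
  odd_perm (s ^+ n) = odd n && odd_perm s.
Proof.
elim: n => [|n IHn]; first by rewrite expg0 odd_perm1.
by rewrite expgS odd_permM IHn /=; case: (odd n); case: (odd_perm s).
Qed.

(* The coset action on n points is faithful since its kernel is too small to
contain a nontrivial conjugacy class; its image is even because the elements
of order 3 and 5 act evenly and are too many for a proper subgroup. *)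
Lemma isog_Alt (gT : finGroupType) (G Q : {group gT}) n :
    orders1235 G -> #|G| %| 60 -> Q \subset G -> #|G : Q| = n -> 1 < n ->
    (2 * #|G|)%N = n`! -> 5 * #|Q|.-1 < #|G| ->
    #|G| < 2 * (#|order_class G 3| + #|order_class G 5|) ->
  G \isog 'Alt_('I_n).
Proof.
move=> oG G60 sQG GQn n1 Gn smallQ ltG.
have core1 : gcore Q G = 1.
  apply: small_normal_trivial oG G60 (gcore_normal sQG) _.
  apply: leq_ltn_trans smallQ; rewrite leq_mul2l -!subn1 leq_sub2r //.
  by rewrite subset_leq_card ?gcore_sub.
have trivC : 'C_G(rcosets Q G | 'Rs) = 1.
  by rewrite astabRs_rcosets core1; apply/trivgP/subsetIr.
have [K /isogP[f injf fG]] := acts_isog_Sym GQn (actsRs_rcosets Q G) trivC.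
have oAlt : #|'Alt_('I_n)| = #|G|.
  apply/eqP; rewrite -(eqn_pmul2l (isT : 0 < 2)) card_Alt ?card_ord //.
  by rewrite Gn.
have sub_Alt : G \subset f @*^-1 'Alt_('I_n).
  have sMG : f @*^-1 'Alt_('I_n) \subset G by apply: subsetIl.
  have M1 : order_class G 3 :|: order_class G 5 \subset f @*^-1 'Alt_('I_n).
    apply/subsetP=> x /setUP xE.
    have [Gx ox] : x \in G /\ ((#[x] == 3) || (#[x] == 5)).
      by case: xE; rewrite inE => /andP[-> ->]; rewrite ?orbT.
    apply/morphpreP; split=> //=; rewrite Alt_even.
    have := odd_permX (f x) #[x].
    rewrite -morphX // expg_order morph1 odd_perm1.
    by case/orP: ox => /eqP-> /= <-.
  have : #|order_class G 3| + #|order_class G 5| <= #|f @*^-1 'Alt_('I_n)|.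
    have [_] := leq_card_setU (order_class G 3) (order_class G 5).
    by rewrite disjoint_order_class // => /eqP<-; apply: subset_leq_card.
  (* A subgroup with more than half of the elements of [G] has index 1. *)
  move=> leM; have := leq_trans ltG (leq_mul (leqnn 2) leM).
  rewrite -{1}(Lagrange sMG) mulnC ltn_pmul2r ?cardG_gt0 //.
  by rewrite ltnNge indexg_gt1 negbK.
suff <- : f @* G = 'Alt_('I_n) by apply: sub_isog.
by apply/eqP; rewrite eqEcard sub_morphim_pre // sub_Alt card_injm ?oAlt ?leqnn.
Qed.

(** Here [Q] is the normalizer of a Sylow 3-subgroup, of order 12 / 4 = 3; the bounds are 5 * 2 < 12
    and 12 < 2 * 8. *)
Lemma isog_Alt4 (gT : finGroupType) (G : {group gT}) :
  orders1235 G -> #|G| = 12 -> G \isog 'Alt_('I_4).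
Proof.
move=> oG Ge; have G60 : #|G| %| 60 by rewrite Ge.
have [n3 e3] := card_order12 oG Ge; have [P sylP] := Sylow_exists 3 G.
have oP : #|P| = 3 by rewrite (card_Hall sylP) p_part Ge.
have oN : #|'N_G(P)| = 3.
  apply/eqP; rewrite -(eqn_pmul2r (isT : 0 < 4)) -{1}n3 (card_Syl sylP).
  by rewrite Lagrange ?subsetIl ?Ge.
apply: (@isog_Alt _ G 'N_G(P)) => //; rewrite ?subsetIl ?Ge ?oN //.
  by rewrite -(card_Syl sylP).
by apply: leq_trans (leq_mul (leqnn 2) (leq_trans e3 (leq_addr _ _))).
Qed.

(** Here [Q] is the normalizer of a Sylow 2-subgroup, of order 60 / 5 = 12; the bounds are 5 * 11 <
    60 and 60 < 2 * 44. *)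
Lemma isog_Alt5 (gT : finGroupType) (G : {group gT}) :
  orders1235 G -> #|G| = 60 -> G \isog 'Alt_('I_5).
Proof.
move=> oG Ge; have G60 : #|G| %| 60 by rewrite Ge.
have [_ _ e3 e5] := card_order60_35 oG Ge; have n2 := card_order60_2 oG Ge.
have [S sylS] := Sylow_exists 2 G.
have oN : #|'N_G(S)| = 12.
  apply/eqP; rewrite -(eqn_pmul2r (isT : 0 < 5)) -{1}n2 (card_Syl sylS).
  by rewrite Lagrange ?subsetIl ?Ge.
apply: (@isog_Alt _ G 'N_G(S)) => //; rewrite ?subsetIl ?Ge ?oN //.
  by rewrite -(card_Syl sylS).
by apply: leq_trans (leq_mul (leqnn 2) (leq_add e3 e5)).
Qed.

(** For each possible order, A_5 has a subgroup of that order to which the same classification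
    applies: trivial, cyclic by Cauchy, a Sylow 2-subgroup, a Sylow normalizer or A_5 itself. *)
Lemma embed_in_Alt5 (gT : finGroupType) (G : {group gT}) :
    orders1235 'Alt_('I_5) -> orders1235 G -> #|G| %| 60 ->
  exists2 H : {group 'S_5}, H \subset 'Alt_('I_5) & G \isog H.
Proof.
set A := 'Alt_('I_5)%G => oA oG G60.
have Ae : #|A| = 60.
  by apply/eqP; rewrite -(eqn_pmul2l (isT : 0 < 2)) card_Alt card_ord.
have A60 : #|A| %| 60 by rewrite Ae.
have [n3 n5 _ _] := card_order60_35 oA Ae; have n2 := card_order60_2 oA Ae.
have normA p (P : {group 'S_5}) m :
    p.-Sylow(A) P -> (m * #|'Syl_p(A)| = 60)%N -> 0 < #|'Syl_p(A)| ->
  #|'N_A(P)| = m.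
  move=> sylP e s0; apply/eqP; rewrite -(eqn_pmul2r s0) e (card_Syl sylP).
  by rewrite Lagrange ?subsetIl ?Ae.
have oN (P : {group 'S_5}) : orders1235 'N_A(P).
  by apply: orders1235S oA; apply: subsetIl.
have prime_case p : prime p -> p %| 60 -> #|G| = p ->
    exists2 H : {group 'S_5}, H \subset A & G \isog H.
  move=> p_pr p60 Gp; have [||x Ax ox] := @Cauchy _ p A => //.
    by rewrite Ae.
  exists <[x]>%G; first by rewrite cycle_subG.
  have cG : cyclic G by rewrite prime_cyclic ?Gp.
  by rewrite (isog_cyclic_card _ cG) cycle_cyclic -orderE ox Gp eqxx.
have dih_case p : p \in [:: 3; 5]%N -> #|G| = p.*2 ->
    exists2 H : {group 'S_5}, H \subset A & G \isog H.
  move=> p35 Gp; have [P sylP] := Sylow_exists p A.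
  exists 'N_A(P)%G; first exact: subsetIl.
  have [p_pr odd_p] : prime p /\ odd p.
    by move: p35; rewrite !inE => /orP[]/eqP->.
  have Np : #|'N_A(P)| = p.*2.
    apply: normA sylP _ _; move: p35; rewrite !inE => /orP[]/eqP->;
      by rewrite ?n3 ?n5.
  apply: isog_trans (isog_dihedral_2p oG p_pr odd_p Gp) _.
  by rewrite isog_sym; apply: (isog_dihedral_2p (oN P) p_pr odd_p Np).
have := card_order60 oG G60; rewrite !inE.
case/or4P=> [/eqP Ge|/eqP|/eqP|/or4P[/eqP Ge|/eqP|/eqP|/or3P[/eqP|/eqP Ge|]]].
- exists 1%G; first exact: sub1G.
  by rewrite (card1_trivg Ge) isog_cyclic_card cyclic1 ?cards1.
- exact: prime_case.
- exact: prime_case.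
- have [S sylS] := Sylow_exists 2 A; exists S; first exact: pHall_sub sylS.
  have oS : #|S| = 4 by rewrite (card_Hall sylS) p_part Ae.
  have abel2 (rT : finGroupType) (K : {group rT}) :
      orders1235 K -> #|K| = 4 -> 2.-abelem K.
    move=> oK Ke; have pK : 2.-group K by rewrite /pgroup Ke.
    apply/abelemP => //; split; first by rewrite (p2group_abelian pK) ?Ke.
    move=> x Kx; have [-> | ntx] := eqVneq x 1; first exact: expg1n.
    by rewrite -{1}(order_pelt oK _ Kx (mem_p_elt pK Kx) ntx) ?expg_order.
  rewrite (isog_abelem_card _ (abel2 _ _ oG Ge)) abel2 ?oS ?Ge //.
  exact: orders1235S (pHall_sub sylS) oA.
- exact: prime_case.
- exact: (dih_case 3).
- exact: (dih_case 5).
- have [S sylS] := Sylow_exists 2 A; exists 'N_A(S)%G; first exact: subsetIl.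
  apply: isog_trans (isog_Alt4 oG Ge) _.
  rewrite isog_sym; apply: isog_Alt4 (oN S) _.
  by apply: normA sylS _ _; rewrite n2.
- by move/eqP=> Ge; exists A => //; apply: isog_Alt5.
Qed.

(** * Consequences of the identities *)

Definition monomial3 (i j k : nat) : word 3 :=
  WMul (WMul (wpow (@WVar 3 (@Ordinal 3 0 isT)) i)
             (wpow (@WVar 3 (@Ordinal 3 1 isT)) j))
       (wpow (@WVar 3 (@Ordinal 3 2 isT)) k).

(** Evaluating the nested filters once leaves thirteen explicit words, with the exponents of the
    monomials still visible. *)
Lemma did3E : did3 =
  let x := @WVar 3 (@Ordinal 3 0 isT) in
  let y := @WVar 3 (@Ordinal 3 1 isT) in
  let z := @WVar 3 (@Ordinal 3 2 isT) in
  [:: wpow x 15; wpow y 15; wpow z 15;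
      wpow (WMul x y) 15; wpow (WMul x z) 15; wpow (WMul y z) 15;
      monomial3 0 0 1; monomial3 0 1 0; monomial3 0 1 1; monomial3 1 0 0;
      monomial3 1 0 1; monomial3 1 1 0; monomial3 1 1 1]%N.
Proof. by []. Qed.

Section DisjunctiveIdentities.
Variable gT : finGroupType.
Local Notation F := (Grp_of_fin gT).

Lemma weval_pow k (x : 'I_k -> F) w n :
  weval x (wpow w n) = (weval x w : gT) ^+ n.
Proof. by elim: n => //= n ->; rewrite expgSr. Qed.

Lemma weval_var k (x : 'I_k -> F) i : weval x (WVar i) = x i.
Proof. by []. Qed.

Lemma weval_mul k (x : 'I_k -> F) u v :
  weval x (WMul u v) = (weval x u : gT) * weval x v.
Proof. by []. Qed.

Lemma weval_eq k (x : 'I_k -> F) u v :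
  (weval x (weq u v) == 1 :> gT) = (weval x u == weval x v :> gT).
Proof. by rewrite [RHS]eq_mulgV1. Qed.

Lemma dsat_hasP k (fs : seq (word k)) :
  dsat F fs <-> forall x : 'I_k -> F, has (fun w => weval x w == 1 :> gT) fs.
Proof.
split=> sat x; have := sat x.
  case=> w w_in /eqP wx; elim: fs w_in {sat} => //= u fs IH [-> | /IH->].
    by rewrite wx.
  by rewrite orbT.
elim: fs {sat} => //= u fs IH /orP[/eqP ux | /IH[w w_in wx]].
  by exists u; [left |].
by exists w; [right |].
Qed.

Local Arguments weval : simpl never.
Local Arguments wpow : simpl never.
Local Arguments weq : simpl never.

(** The rules for [weq] and [wpow] precede the product rule because both unfold to products. *)
Let weE := (weval_eq, weval_pow, weval_mul, weval_var).

Lemma did2P : dsat F did2 ->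
  forall x : gT, [|| x ^+ 2 == 1, x ^+ 3 == 1 | x ^+ 5 == 1].
Proof.
move=> /dsat_hasP sat x; have := sat (fun=> x).
by rewrite /= !weE orbF.
Qed.

Lemma did3P : dsat F did3 -> forall x y z : gT,
  [|| x ^+ 15 == 1, y ^+ 15 == 1, z ^+ 15 == 1,
      (x * y) ^+ 15 == 1, (x * z) ^+ 15 == 1, (y * z) ^+ 15 == 1,
      z == 1, y == 1, y * z == 1, x == 1, x * z == 1, x * y == 1
    | x * y * z == 1].
Proof.
move=> /dsat_hasP sat x y z.
have := sat (fun i : 'I_3 => nth (1 : gT) [:: x; y; z] i).
by rewrite did3E /=; rewrite !weE /= !expg0 !expg1 !mulg1 !mul1g orbF.
Qed.

Lemma did4P : dsat F did4 -> forall x y : gT,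
  [|| x ^+ 10 == 1, y ^+ 10 == 1, x == y, (x * y) ^+ 10 == 1
    | (x ^+ 2 * y) ^+ 2 == 1].
Proof.
move=> /dsat_hasP sat x y.
have := sat (fun i : 'I_2 => nth (1 : gT) [:: x; y] i).
by rewrite /= !weE /= orbF.
Qed.

Lemma did5P : dsat F did5 -> forall x y : gT,
  [|| x ^+ 6 == 1, y ^+ 6 == 1, (x * y) ^+ 6 == 1, (x * y ^+ 2) ^+ 6 == 1,
    (x * y ^+ 3) ^+ 6 == 1 | (x * y ^+ 4) ^+ 6 == 1].
Proof.
move=> /dsat_hasP sat x y.
have := sat (fun i : 'I_2 => nth (1 : gT) [:: x; y] i).
by rewrite /= !weE /= orbF.
Qed.

Lemma orders1235_did2 (G : {set gT}) : dsat F did2 -> orders1235 G.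
Proof.
move=> /did2P sat x _; have := sat x; rewrite -!order_dvdn => /or3P[].
- by rewrite dvdn_divisors // !inE => /orP[] ->; rewrite ?orbT.
- by rewrite dvdn_divisors // !inE => /orP[] ->; rewrite ?orbT.
by rewrite dvdn_divisors // !inE => /orP[] ->; rewrite ?orbT.
Qed.

End DisjunctiveIdentities.

(** * The bound on the group order *)

Lemma expg_coprime_eq1 (gT : finGroupType) (x : gT) m n :
  coprime m n -> x ^+ m = 1 -> (x ^+ n == 1) = (x == 1).
Proof.
move=> co_mn xm; apply/idP/eqP=> [|->]; last by rewrite expg1n.
rewrite -order_dvdn => xn; apply/eqP; rewrite -order_eq1 -dvdn1.
by rewrite -(eqP co_mn) dvdn_gcd xn order_dvdn xm eqxx.
Qed.

Lemma exists_notin_seq (T : finType) (A : {set T}) (s : seq T) :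
  size s < #|A| -> exists2 x, x \in A & x \notin s.
Proof.
move=> lt_sA; apply/subsetPn; apply: contraL lt_sA => sAs.
by rewrite -leqNgt (leq_trans (subset_leq_card sAs)) ?card_size.
Qed.

Lemma exists_subgroup_pexp (gT : finGroupType) (G : {group gT}) p r :
  prime p -> r <= logn p #|G| ->
  exists2 Q : {group gT}, Q \subset G & #|Q| = (p ^ r)%N.
Proof.
move=> p_pr le_r; have [P sylP] := Sylow_exists p G.
have lP : r <= logn p #|P| by rewrite (card_Hall sylP) logn_part.
have [Q [sQP _ oQ]] := normal_pgroup (pHall_pgroup sylP) (normal_refl P) lP.
by exists Q => //; apply: subset_trans sQP (pHall_sub sylP).
Qed.

(* Identities (3), (4) and (5) fail at generators of an elementary abelian
subgroup of order 8, 9 and 25, respectively. *)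
Lemma dvdn60_dids (gT : finGroupType) :
    dsat (Grp_of_fin gT) did2 -> dsat (Grp_of_fin gT) did3 ->
    dsat (Grp_of_fin gT) did4 -> dsat (Grp_of_fin gT) did5 ->
  #|[set: gT]| %| 60.
Proof.
move=> h2 /did3P h3 /did4P h4 /did5P h5; pose G := [set: gT]%G.
have oG : orders1235 G by apply: orders1235_did2.
have expQ p (Q : {group gT}) x : prime p -> p.-group Q -> x \in Q -> x ^+ p = 1.
  move=> p_pr pQ Qx; have [-> | ntx] := eqVneq x 1; first exact: expg1n.
  by rewrite -(order_pelt oG p_pr (in_setT x) (mem_p_elt pQ Qx) ntx) expg_order.
have pQ p r (Q : {group gT}) : prime p -> #|Q| = (p ^ r)%N -> p.-group Q.
  by move=> p_pr oQ; rewrite /pgroup oQ pnatX pnat_id.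
have l2 : logn 2 #|G| <= 2.
  rewrite leqNgt; apply/negP=> /(exists_subgroup_pexp (isT : prime 2))[Q _ oQ].
  have q2 x : x \in Q -> x ^+ 2 = 1 by apply: expQ; rewrite ?(pQ 2 3).
  have [x Qx] : exists2 x, x \in Q & x \notin [:: 1].
    by apply: exists_notin_seq; rewrite oQ.
  have [y Qy] : exists2 y, y \in Q & y \notin [:: 1; x].
    by apply: exists_notin_seq; rewrite oQ.
  have [z Qz] : exists2 z, z \in Q & z \notin [:: 1; x; y; x * y].
    by apply: exists_notin_seq; rewrite oQ.
  have inv u : u \in Q -> u^-1 = u.
    by move=> /q2 u2; apply/eqP; rewrite eq_invg_mul -expg2 u2.
  (* As 15 is coprime to 2, a 15th power is trivial only at 1; the exponents 10 and 6 do the same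
     for the primes 3 and 5. *)
  have e15 u : u \in Q -> (u ^+ 15 == 1) = (u == 1).
    by move=> /q2; apply: expg_coprime_eq1.
  have m u v : u \in Q -> (u * v == 1) = (v == u).
    by move=> Qu; rewrite -eq_invg_mul inv // eq_sym.
  (* Every disjunct now puts [x], [y] or [z] into the list it was chosen to avoid. *)
  have := h3 x y z; rewrite !e15 ?groupM // !m ?groupM // !inE.
  by do !case: (_ == _).
have l3 : logn 3 #|G| <= 1.
  rewrite leqNgt; apply/negP=> /(exists_subgroup_pexp (isT : prime 3))[Q _ oQ].
  have q3 x : x \in Q -> x ^+ 3 = 1 by apply: expQ; rewrite ?(pQ 3 2).
  have [x Qx] : exists2 x, x \in Q & x \notin [:: 1].
    by apply: exists_notin_seq; rewrite oQ.
  have [y Qy] : exists2 y, y \in Q & y \notin [:: 1; x; x^-1].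
    by apply: exists_notin_seq; rewrite oQ.
  have eQ n u : coprime 3 n -> u \in Q -> (u ^+ n == 1) = (u == 1).
    by move=> co_n /q3; apply: expg_coprime_eq1.
  have x2 : x ^+ 2 = x^-1 by apply/eqP; rewrite eq_sym eq_invg_mul -expgS q3.
  (* The last two disjuncts become [y = x^-1] and, since [x ^+ 2 = x^-1], [y = x]. *)
  have := h4 x y; rewrite !eQ ?groupM ?groupX // x2 -!eq_invg_mul invgK !inE.
  by rewrite ![_ == y]eq_sym; do !case: (_ == _).
have l5 : logn 5 #|G| <= 1.
  rewrite leqNgt; apply/negP=> /(exists_subgroup_pexp (isT : prime 5))[Q _ oQ].
  have q5 x : x \in Q -> x ^+ 5 = 1 by apply: expQ; rewrite ?(pQ 5 2).
  have [x Qx] : exists2 x, x \in Q & x \notin [:: 1].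
    by apply: exists_notin_seq; rewrite oQ.
  rewrite inE => ntx; have [y Qy nxy] : exists2 y, y \in Q & y \notin <[x]>.
    apply/subsetPn/negP=> /subset_leq_card.
    have: #[x] <= 5 by rewrite dvdn_leq // order_dvdn q5.
    by rewrite oQ -orderE => le5 /leq_trans/(_ le5).
  have eQ u : u \in Q -> (u ^+ 6 == 1) = (u == 1).
    by move=> /q5; apply: expg_coprime_eq1.
  have nxyX n : (y * x ^+ n == 1) = false.
    apply: contraNF nxy; rewrite -eq_invg_mul -groupV => /eqP->.
    exact: mem_cycle.
  have := h5 y x; rewrite !eQ ?groupM ?groupX // (negPf ntx) !nxyX.
  (* The exponents 0 and 1 account for the disjuncts [y == 1] and [y * x == 1], where no power of
     [x] is written. *)
  have := nxyX 1%N; have := nxyX 0%N; rewrite expg0 expg1 mulg1.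
  by move=> -> ->.
(* Each prime part is compared with 60; by Cauchy, a prime divisor is the order of an element, hence
   2, 3 or 5. *)
apply/dvdn_partP; first exact: cardG_gt0.
move=> p; rewrite mem_primes => /and3P[p_pr _ /(Cauchy p_pr)[x _ ox]].
have := oG x (in_setT x); rewrite ox p_part !inE => /or4P[] /eqP e.
- by rewrite e in p_pr.
- by rewrite e (dvdn_trans (dvdn_exp2l 2 l2)).
- by rewrite e (dvdn_trans (dvdn_exp2l 3 l3)).
- by rewrite e (dvdn_trans (dvdn_exp2l 5 l5)).
Qed.

(** * The identities in A_5 *)

(* MathComp permutations do not compute, so the identities are checked on lists
of values instead. *)
Definition perm_code (s : 'S_5) : seq nat := [seq val (s i) | i <- enum 'I_5].

(** Composition from left to right, as for permutations: [l] acts first. *)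
Definition code_mul (l m : seq nat) : seq nat := map (nth 0%N m) l.

Definition code_inv (l : seq nat) : seq nat := map (index^~ l) (iota 0 5).

(* Parity of the number of inversions. *)
Fixpoint code_odd (l : seq nat) : bool :=
  if l is a :: l' then odd (count (fun b => b < a)%N l') (+) code_odd l'
  else false.

Definition lists_below m n : seq (seq nat) :=
  iter n (allpairs cons (iota 0 m)) [:: [::]].

Definition codes : seq (seq nat) := filter uniq (lists_below 5 5).

Definition even_codes : seq (seq nat) := filter (fun l => ~~ code_odd l) codes.

Fixpoint code_eval k (y : 'I_k -> seq nat) (w : word k) : seq nat :=
  match w with
  | WVar i => y i
  | WOne => iota 0 5
  | WMul u v => code_mul (code_eval y u) (code_eval y v)
  | WInv u => code_inv (code_eval y u)
  end.

Lemma nth_perm_code s (i : 'I_5) : nth 0%N (perm_code s) i = s i.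
Proof. by rewrite (nth_map i) ?nth_ord_enum // size_enum_ord. Qed.

Lemma perm_code_inj : injective perm_code.
Proof.
move=> s t e; apply/permP=> i; apply/val_inj.
rewrite /= -[RHS]nth_perm_code -e; exact/esym/nth_perm_code.
Qed.

Lemma perm_code1 : perm_code 1 = iota 0 5.
Proof. by rewrite -val_enum_ord; apply: eq_map => i; rewrite perm1. Qed.

Lemma perm_codeM s t : perm_code (s * t) = code_mul (perm_code s) (perm_code t).
Proof.
rewrite /code_mul -map_comp; apply: eq_map => i.
by rewrite /= nth_perm_code permM.
Qed.

Lemma perm_codeV s : perm_code s^-1 = code_inv (perm_code s).
Proof.
rewrite /code_inv -val_enum_ord -map_comp; apply: eq_map => i /=.
rewrite -{2}(permKV s i) /perm_code (index_map (inj_comp val_inj perm_inj)).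
by rewrite index_enum_ord.
Qed.

Lemma mem_lists_below m (l : seq nat) :
  all (fun k => k < m) l -> l \in lists_below m (size l).
Proof.
elim: l => //= a l IH /andP[lt_am /IH]; apply: allpairs_f.
by rewrite mem_iota.
Qed.

Lemma mem_perm_code s : perm_code s \in codes.
Proof.
rewrite mem_filter map_inj_uniq ?enum_uniq;
  last exact: inj_comp val_inj perm_inj.
have /mem_lists_below : all (fun k => k < 5) (perm_code s).
  by apply/allP=> _ /mapP[i _ ->]; apply: ltn_ord.
by rewrite size_map size_enum_ord.
Qed.

Definition code_swap (i j : nat) : seq nat :=
  [seq (if k == i then j else if k == j then i else k) | k <- iota 0 5].

Lemma perm_code_tperm (i j : 'I_5) :
  perm_code (tperm i j) = code_swap i j.
Proof.
rewrite /code_swap -val_enum_ord -map_comp; apply: eq_map => k /=.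
by rewrite permE /= !(fun_if val).
Qed.

(** Both parities vanish at the identity and flip under multiplication by a transposition, which for
    codes is checked exhaustively; transpositions generate the group. *)
Lemma code_oddE s : code_odd (perm_code s) = odd_perm s.
Proof.
have swap_odd : all (fun i => all (fun j => all (fun l =>
    (i == j) || (code_odd (code_mul (code_swap i j) l) == ~~ code_odd l))
  codes) (iota 0 5)) (iota 0 5) by vm_compute.
have {}swap_odd (i j : 'I_5) t : i != j ->
    code_odd (perm_code (tperm i j * t)) = ~~ code_odd (perm_code t).
  move=> neq_ij; rewrite perm_codeM perm_code_tperm.
  have mI (k : 'I_5) : (k : nat) \in iota 0 5 by rewrite mem_iota /=.
  move/allP/(_ _ (mI i))/allP/(_ _ (mI j)): swap_odd.
  move/allP/(_ _ (mem_perm_code t)).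
  by rewrite (inj_eq val_inj) (negPf neq_ij) => /eqP.
have [ts -> {s}] := prod_tpermP s; elim: ts => [|[i j] ts IH] /=.
  by rewrite big_nil perm_code1 odd_perm1.
case/andP=> neq_ij dts; rewrite big_cons swap_odd // IH // odd_permM odd_tperm.
by rewrite neq_ij.
Qed.

Lemma mem_even_codes s : s \in 'Alt_('I_5) -> perm_code s \in even_codes.
Proof. by rewrite Alt_even mem_filter mem_perm_code code_oddE andbT. Qed.

Lemma perm_code_weval k (x : 'I_k -> A5) w :
  perm_code (sgval (weval x w : [subg 'Alt_('I_5)])) =
    code_eval (fun i => perm_code (sgval (x i : [subg 'Alt_('I_5)]))) w.
Proof.
elim: w => //= [|u IHu v IHv|u IHu].
- exact: perm_code1.
- by rewrite perm_codeM IHu IHv.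
- by rewrite perm_codeV IHu.
Qed.

(** Since [perm_code] is injective and respects word evaluation, an identity can be tested on the
    finite list [even_codes]. *)
Lemma dsat_A5 k (fs : seq (word k)) :
    (forall y : 'I_k -> seq nat, (forall i, y i \in even_codes) ->
       has (fun w => code_eval y w == iota 0 5) fs) ->
  dsat A5 fs.
Proof.
move=> chk; apply/dsat_hasP=> x.
have mem_x i : perm_code (sgval (x i : [subg 'Alt_('I_5)])) \in even_codes.
  by apply: mem_even_codes; apply: subgP.
move/chk: mem_x; apply: sub_has => w; rewrite -perm_code_weval -perm_code1.
by rewrite (inj_eq perm_code_inj) => /eqP e; apply/eqP/val_inj.
Qed.

Definition code_pow (l : seq nat) n :=
  iter n (fun m => code_mul m l) (iota 0 5).

Lemma code_eval_pow k (y : 'I_k -> seq nat) w n :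
  code_eval y (wpow w n) = code_pow (code_eval y w) n.
Proof. by elim: n => //= n ->. Qed.

(** * Verification of the five identities *)

Lemma In_mapP (T : eqType) (U : Type) (f : T -> U) (s : seq T) u :
  List.In u (map f s) <-> exists2 a, a \in s & u = f a.
Proof.
split=> [|[a + ->]]; elim: s => //= b s IH.
  case=> [<- | /IH[a sa ->]]; first by exists b; rewrite ?mem_head.
  by exists a; rewrite // inE sa orbT.
by rewrite inE => /orP[/eqP-> | /IH]; [left | right].
Qed.

Lemma dsat_did1P (G : Grp) :
  dsat G did1 <->
    forall x : 'I_61 -> G, exists i j : 'I_61, (i < j)%N /\ x i = x j.
Proof.
(* The axioms give only a left identity and left inverses; the right-hand laws are derived here. *)
have mulVr (u : G) : gmul u (ginv u) = gone G.
  rewrite -[gmul u _]gmul1 -{1}(gmulV (ginv u)) -gmulA.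
  by rewrite [gmul (ginv u) _]gmulA gmulV gmul1 gmulV.
have mul1r (u : G) : gmul u (gone G) = u.
  by rewrite -(gmulV u) gmulA mulVr gmul1.
split=> sat x.
  have [_ /In_mapP[[i j] + ->]] := sat x.
  rewrite mem_filter => /andP[/= lt_ij _] /= e; exists i, j; split=> //.
  by rewrite -[x i]mul1r -(gmulV (x j)) gmulA e gmul1.
have [i [j [lt_ij e]]] := sat x.
exists (weq (WVar i) (WVar j)); last by rewrite /= e mulVr.
apply/In_mapP; exists (i, j) => //; rewrite mem_filter lt_ij.
by apply: allpairs_f; rewrite mem_enum.
Qed.

(** Pigeonhole: 61 values in a group of order 60. *)
Lemma A5_did1 : dsat A5 did1.
Proof.
have oA : #|{: subg_of 'Alt_('I_5)%G}| = 60.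
  rewrite -cardsT -(card_isog (isog_subg _)); apply/eqP.
  by rewrite -(eqn_pmul2l (isT : 0 < 2)) card_Alt card_ord.
apply/dsat_did1P=> x.
have : ~~ injectiveb (x : 'I_61 -> [subg 'Alt_('I_5)]).
  by apply/negP=> /injectiveP/leq_card; rewrite card_ord oA.
case/injectivePn=> i [j neq_ij eq_x].
case: (ltngtP i j) => [lt_ij | lt_ji | /val_inj e].
- by exists i, j.
- by exists j, i.
by rewrite e eqxx in neq_ij.
Qed.

Section CodeChecks.

Local Arguments code_eval : simpl never.
Local Arguments wpow : simpl never.
Local Arguments code_pow : simpl never.
Local Arguments code_mul : simpl never.
Local Arguments code_inv : simpl never.
Local Notation id5 := (iota 0 5).

Lemma code_eval_var k (y : 'I_k -> seq nat) i : code_eval y (WVar i) = y i.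
Proof. by []. Qed.

Lemma code_eval_mul k (y : 'I_k -> seq nat) u v :
  code_eval y (WMul u v) = code_mul (code_eval y u) (code_eval y v).
Proof. by []. Qed.

Lemma code_eval_eq k (y : 'I_k -> seq nat) u v :
  code_eval y (weq u v) = code_mul (code_eval y u) (code_inv (code_eval y v)).
Proof. by []. Qed.

Let ceE := (code_eval_eq, code_eval_pow, code_eval_mul, code_eval_var).

(** For n = 15, 10 and 6 these are the codes of the 15 involutions, the 20 elements of order 3 and
    the 24 of order 5; the checks in two and three variables run over them alone. *)
Definition codes_not_killed n :=
  [seq l <- even_codes | code_pow l n != id5].

Lemma codes_not_killedP n l : l \in even_codes ->
  (code_pow l n == id5) || (l \in codes_not_killed n).
Proof. by move=> le; rewrite mem_filter le andbT orbN. Qed.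

Lemma A5_did2 : dsat A5 did2.
Proof.
apply: dsat_A5 => y ye; rewrite [has _ _]/= !ceE orbF; move: (ye ord0).
move: (y ord0) => a; move: a; apply/allP; by vm_compute.
Qed.

Lemma A5_did4 : dsat A5 did4.
Proof.
apply: dsat_A5 => y ye; rewrite [has _ _]/= !ceE orbF.
have := codes_not_killedP 10 (ye (@Ordinal 2 0 isT)).
have := codes_not_killedP 10 (ye (@Ordinal 2 1 isT)).
move: (y _) => b; move: (y _) => a; case: eqP => [_|_ /= Tb]; rewrite ?orbT //.
case: eqP => //= _ Ta.
have : all (fun a => all (fun b => [|| code_mul a (code_inv b) == id5,
    code_pow (code_mul a b) 10 == id5
    | code_pow (code_mul (code_pow a 2) b) 2 == id5])
   (codes_not_killed 10)) (codes_not_killed 10) by vm_compute.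
by move/allP/(_ _ Ta)/allP/(_ _ Tb).
Qed.

Lemma A5_did5 : dsat A5 did5.
Proof.
apply: dsat_A5 => y ye; rewrite [has _ _]/= !ceE orbF.
have := codes_not_killedP 6 (ye (@Ordinal 2 0 isT)).
have := codes_not_killedP 6 (ye (@Ordinal 2 1 isT)).
move: (y _) => b; move: (y _) => a; case: eqP => [_|_ /= Tb]; rewrite ?orbT //.
case: eqP => //= _ Ta.
have : all (fun a => all (fun b =>
    has (fun d => code_pow (code_mul a (code_pow b d)) 6 == id5)
      [:: 1; 2; 3; 4]%N)
   (codes_not_killed 6)) (codes_not_killed 6) by vm_compute.
by move/allP/(_ _ Ta)/allP/(_ _ Tb); rewrite /= orbF.
Qed.

Lemma A5_did3 : dsat A5 did3.
Proof.
apply: dsat_A5 => y ye; rewrite did3E [has _ _]/= !ceE orbF.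
have := codes_not_killedP 15 (ye (@Ordinal 3 0 isT)).
have := codes_not_killedP 15 (ye (@Ordinal 3 1 isT)).
have := codes_not_killedP 15 (ye (@Ordinal 3 2 isT)).
move: (y _) => c; move: (y _) => b; move: (y _) => a.
case: eqP => [_|_ /= Tc]; rewrite ?orbT //.
case: eqP => [_|_ /= Tb]; rewrite ?orbT //.
case: eqP => //= _ Ta.
(* If [a], [b], [c] and their pairwise products are all involutions, then [a], [b], [c] are the
   three involutions of a Klein four-group, and abc = 1. *)
have : all (fun a => all (fun b => (code_pow (code_mul a b) 15 == id5) ||
    all (fun c => [|| code_pow (code_mul a c) 15 == id5,
      code_pow (code_mul b c) 15 == id5,
      code_mul (code_mul (code_pow a 1) (code_pow b 1)) (code_pow c 0) == id5
    | code_mul (code_mul (code_pow a 1) (code_pow b 1)) (code_pow c 1) == id5])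
    (codes_not_killed 15)) (codes_not_killed 15)) (codes_not_killed 15).
  by vm_compute.
move/allP/(_ _ Ta)/allP/(_ _ Tb)/orP; case=> [-> | /allP/(_ _ Tc)].
  by rewrite ?orbT.
by case/or4P=> ->; rewrite ?orbT.
Qed.

End CodeChecks.

Lemma A5_satisfies_all : satisfies_all A5.
Proof.
split; [exact: A5_did1|exact: A5_did2|exact: A5_did3|exact: A5_did4|].
exact: A5_did5.
Qed.

(** * Abstract groups *)

(** For the largest m admitting an injection [g] from ['I_m], a point outside the image would extend
    [g] to ['I_m.+1]; so [g] is onto, and a choice of preimages is the required [f]. *)
Lemma finite_of_no_injection (T : Type) m :
    ~ (exists f : 'I_m -> T, injective f) ->
  exists n, exists f : T -> 'I_n, exists g : 'I_n -> T, cancel f g.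
Proof.
elim: m => [|m IH] noinj.
  have e (i : 'I_0) : False by case: i.
  by case: noinj; exists (fun i => match e i with end) => i; case: (e i).
have [[g g_inj] | /IH //] := classic (exists f : 'I_m -> T, injective f).
have g_onto x : exists i, g i = x.
  apply: NNPP => nx; apply: noinj.
  exists (fun i : 'I_m.+1 => if unlift ord_max i is Some j then g j else x).
  move=> i j; case: unliftP => [i'|] ->; case: unliftP => [j'|] -> //.
  - by move/g_inj->.
  - by move=> e; case: nx; exists i'.
  - by move=> e; case: nx; exists j'.
pose g_sig x := constructive_indefinite_description _ (g_onto x).
by exists m, (fun x => proj1_sig (g_sig x)), g => x; case: (g_sig x).
Qed.

(* The phantom argument of type cancel f g drives the inference of the finite
group structure. *)
Definition fin_carrier (G : Grp) n (f : G -> 'I_n) g of cancel f g : Type := G.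

Section FiniteGrp.
Variables (G : Grp) (n : nat) (f : G -> 'I_n) (g : 'I_n -> G).
Hypothesis fK : cancel f g.
Local Notation T := (fin_carrier fK).

HB.instance Definition _ := Finite.copy T (can_type fK).
HB.instance Definition _ :=
  Finite_isGroup.Build T (@gmulA G) (@gmul1 G) (@gmulV G).

Lemma fin_carrier_weval k (x : 'I_k -> G) w :
  @weval (Grp_of_fin T) k x w = weval x w.
Proof. by elim: w => //= [u -> v -> | u ->]. Qed.

Lemma fin_carrier_dsat k (fs : seq (word k)) :
  dsat G fs -> dsat (Grp_of_fin T) fs.
Proof.
move=> sat x; have [w w_in wx] := sat x.
by exists w => //; rewrite fin_carrier_weval.
Qed.

Lemma fin_carrier_section :
    dsat G did2 -> dsat G did3 -> dsat G did4 -> dsat G did5 ->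
  section_of_A5 G.
Proof.
move=> h2 h3 h4 h5; have sat := fin_carrier_dsat.
have d60 := dvdn60_dids (sat _ _ h2) (sat _ _ h3) (sat _ _ h4) (sat _ _ h5).
have oG : orders1235 [set: T] := orders1235_did2 (sat _ _ h2).
(* The element orders of A_5 are read off from its second identity and carried over to
   permutations. *)
have oA : orders1235 'Alt_('I_5).
  have oS : orders1235 [set: subg_of 'Alt_('I_5)%G].
    exact: orders1235_did2 A5_did2.
  move=> s As; rewrite -(subgK _ As) (order_injm (injm_sgval _)) ?in_setT //.
  exact: oS (in_setT _).
have [H sHA isoH] := embed_in_Alt5 oA oG d60.
(* The section is a subgroup of A_5, presented as its quotient by the trivial group. *)
exists H, 1%G; split=> //; first exact: normal1.
have /isogP[h injh hH] : (H / 1) \isog [set: T].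
  by rewrite isog_sym (isog_trans isoH) // quotient1_isog.
exists h; split.
- by move=> a b Ha Hb; apply: (morphM h).
- exact: (injmP injh).
move=> u; have : u \in h @* (H / 1) by rewrite hH; apply: in_setT (u : T).
by case/morphimP=> c _ Hc ->; exists c.
Qed.

End FiniteGrp.

Theorem theorem1 :
  satisfies_all A5 /\
  (forall G : Grp, satisfies_all G -> section_of_A5 G).
Proof.
split; first exact: A5_satisfies_all.
move=> G [/dsat_did1P h1 h2 h3 h4 h5].
(* By the first identity, no 61 elements of [G] are pairwise distinct. *)
have [|n [f [g fK]]] := @finite_of_no_injection G 61.
  by case=> x x_inj; have [i [j [+ /x_inj e]]] := h1 x; rewrite e ltnn.
exact: (fin_carrier_section fK).
Qed.
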